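(* Let $X$ be a finite flag complex, let $k\ge 1$, and let $A$ be a $k$-th discrete boundary of $X$ (with $X_k\setminus A_k\neq\emptyset$, so that $\mu_k(X,A)$ is defined). Let $$X'=\Big\{\sigma \;\Big|\; \sigma\subseteq\tau \text{ for some } \tau\in (X_k\setminus A_k)\cup\bigcup_{i\ge k+1}X_i\Big\},$$ which is a subcomplex of $X$, and let $n'$ be the number of vertices of $X'$. Then $$\mu_k(X,A)\ \geq\ (k+1)\lambda_2(G_{X'})-kn'-\max_{\sigma\in X'_k}|\sigma_{k-1}\cap A_{k-1}|.$$ Consequently, if $$\lambda_2(G_{X'})>\frac{1}{k+1}\Big(kn'+\max_{\sigma\in X'_k}|\sigma_{k-1}\cap A_{k-1}|\Big),$$ then $H_k(X,A;\mathbb{R})=0$.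
   Context: A simplicial complex $X$ is a finite collection of finite sets closed under taking subsets, always containing $\emptyset$; $\dim\sigma=|\sigma|-1$; $X_k$ is the set of $k$-dimensional faces; $V(X)$ is the union of all faces. For $\sigma\in X_k$: $\deg_X(\sigma)=|\{\eta\in X_{k+1}:\sigma\subseteq\eta\}|$ and $\sigma_{k-1}=\{\tau\in X_{k-1}:\tau\subseteq\sigma\}$. The flag complex of a graph $G$ is the complex on $V(G)$ whose faces are the vertex subsets spanning complete subgraphs of $G$; a flag complex is one of this form. $G_X$ denotes the $1$-skeleton of $X$ viewed as a graph, and $\lambda_2(G)$ is the second smallest eigenvalue (with multiplicity) of the graph Laplacian (degree matrix minus adjacency matrix) of $G$. For $k\le\dim X$, a subcomplex $A\subseteq X$ is a $k$-th discrete boundary of $X$ if $\deg_X(\sigma)\le 1$ for all $\sigma\in A_{k-1}$. Relative Laplacian and homology: fix a total order on $V(X)$. $C_k(X,A;\mathbb{R})=C_k(X;\mathbb{R})/C_k(A;\mathbb{R})$ is identified with the real vector space with basis $X_k\setminus A_k$; for $\sigma=\{v_0\prec\dots\prec v_k\}$, the relative boundary map $\partial_k(X,A;\mathbb{R})$ sends $[\sigma]$ to $\sum_i(-1)^i[\sigma\setminus\{v_i\}]$, summed over $i$ with $\sigma\setminus\{v_i\}\notin A_{k-1}$. $H_k(X,A;\mathbb{R})=\ker\partial_k/\operatorname{im}\partial_{k+1}$. With adjoints (transposes) with respect to these bases, $L_k(X,A)=\partial_{k+1}\partial_{k+1}^*+\partial_k^*\partial_k$, and $\mu_k(X,A)$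 is its smallest eigenvalue. *)

(* Defs.v *)
From HB Require Import structures.
From mathcomp Require Import all_boot all_order all_algebra.
From mathcomp Require Import polyrcf.
From mathcomp Require Import reals.

Set Implicit Arguments.
Unset Strict Implicit.
Unset Printing Implicit Defensive.

Import Order.TTheory GRing.Theory Num.Theory.
Local Open Scope ring_scope.

Section Graphs.
Variable T : finType.

(* A finite simple graph whose vertex set is a subset of the ambient type T. *)
Record sgraph := SGraph {
  vset : {set T};
  adj : rel T;
  adj_vset : forall u v, adj u v -> (u \in vset) && (v \in vset);
  adj_irr : irreflexive adj;
  adj_sym : symmetric adj
}.

Definition gdeg (G : sgraph) (v : T) : nat := #|[set u in vset G | adj G v u]|.

End Graphs.

Section Spectra.
Variable R : rcfType.

(* The real eigenvalues of M in increasing order, each repeated according to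
   its multiplicity as a root of the characteristic polynomial (rootsR is
   sorted and duplicate-free).  For symmetric M this is the whole spectrum,
   and algebraic and geometric multiplicities agree. *)
Definition eigenvalues n (M : 'M[R]_n) : seq R :=
  flatten [seq nseq (mup x (char_poly M)) x | x <- rootsR (char_poly M)].

Definition graph_laplacian (T : finType) (G : sgraph T) : 'M[R]_#|vset G| :=
  diag_mx (\row_i (gdeg G (enum_val i))%:R)
  - \matrix_(i, j) (adj G (enum_val i) (enum_val j))%:R.

(* Indexing starts at 0; the value is junk (0) for graphs with fewer than two
   vertices. *)
Definition lambda2 (T : finType) (G : sgraph T) : R :=
  nth 0 (eigenvalues (graph_laplacian G)) 1.

End Spectra.

Section Complexes.
Variable T : finType.
Implicit Types (X A : {set {set T}}) (s t : {set T}) (k : nat).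

Definition simplicial_complex X : Prop :=
  set0 \in X /\ (forall s t, s \in X -> t \subset s -> t \in X).

Definition vertices X : {set T} := cover X.

(* X_k; a k-dimensional face has k + 1 elements. *)
Definition faces X k : {set {set T}} := [set s in X | #|s| == k.+1].

Definition cdeg X s : nat := #|[set e in X | (#|e| == #|s|.+1) && (s \subset e)]|.

Definition subfaces X k s : {set {set T}} := [set t in faces X k | t \subset s].

Definition flag_complex (G : sgraph T) : {set {set T}} :=
  [set s : {set T} | (s \subset vset G)
           && [forall u in s, forall v in s, (u != v) ==> adj G u v]].

Definition is_flag X : Prop := exists G : sgraph T, X = flag_complex G.

Definition skel_adj X : rel T := fun u v => (u != v) && ([set u; v] \in X).

Lemma skel_adj_vset X u v :
  skel_adj X u v -> (u \in vertices X) && (v \in vertices X).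
Proof.
case/andP=> _ uvX; apply/andP; split; apply/bigcupP; exists [set u; v] => //.
  by rewrite set21.
by rewrite set22.
Qed.

Lemma skel_adj_irr X : irreflexive (skel_adj X).
Proof. by move=> u; rewrite /skel_adj eqxx. Qed.

Lemma skel_adj_sym X : symmetric (skel_adj X).
Proof. by move=> u v; rewrite /skel_adj eq_sym setUC. Qed.

Definition skeleton_graph X : sgraph T :=
  SGraph (@skel_adj_vset X) (@skel_adj_irr X) (@skel_adj_sym X).

(* The first clause is k <= dim X, since dim X + 1 is the maximal size of a
   face.  Only used for k >= 1, so that k.-1 is k - 1. *)
Definition discrete_boundary X k A : Prop :=
  [/\ (k < \max_(s in X) #|s|)%N,
      simplicial_complex A,
      A \subset X
    & forall s, s \in faces A k.-1 -> (cdeg X s <= 1)%N].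

Definition rel_cells X A k : {set {set T}} := faces X k :\: faces A k.

(* The complex X'; faces of dimension at least k + 1 have at least k + 2
   elements. *)
Definition trunc_complex X A k : {set {set T}} :=
  [set s : {set T} | [exists t in rel_cells X A k :|: [set t in X | (k.+2 <= #|t|)%N],
              s \subset t]].

End Complexes.

Section RelativeHomology.
Variables (R : rcfType) (d : Order.disp_t) (T : finOrderType d).
Implicit Types (X A : {set {set T}}) (k : nat).

Definition vpos (s : {set T}) (v : T) : nat := #|[set u in s | (u < v)%O]|.

(* The coefficient of t in the boundary of s; the sum has at most one term. *)
Definition incidence (s t : {set T}) : R :=
  \sum_(v in s | s :\ v == t) (-1) ^+ vpos s v.

(* Chains are column vectors in the basis rel_cells X A k.  For k = 0 the
   target is meant to be zero; here k.-1 = 0 but the matrix is zero, so kernel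
   and Laplacian are still the expected ones. *)
Definition rel_boundary X A k :
    'M[R]_(#|rel_cells X A k.-1|, #|rel_cells X A k|) :=
  \matrix_(i, j) incidence (enum_val j) (enum_val i).

Definition rel_laplacian X A k : 'M[R]_#|rel_cells X A k| :=
  rel_boundary X A k.+1 *m (rel_boundary X A k.+1)^T
  + (rel_boundary X A k)^T *m rel_boundary X A k.

(* The smallest eigenvalue; junk (0) when rel_cells X A k is empty. *)
Definition mu X A k : R := head 0 (eigenvalues (rel_laplacian X A k)).

Definition rel_chain X A k := 'cV[R]_#|rel_cells X A k|.

Definition rel_cycles X A k : {vspace rel_chain X A k} :=
  lker (linfun (mulmx (rel_boundary X A k))
        : 'Hom('cV[R]_#|rel_cells X A k|, 'cV[R]_#|rel_cells X A k.-1|)).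

Definition rel_boundaries X A k : {vspace rel_chain X A k} :=
  limg (linfun (mulmx (rel_boundary X A k.+1))
        : 'Hom('cV[R]_#|rel_cells X A k.+1|, 'cV[R]_#|rel_cells X A k|)).

Definition cycle_is_boundary X A k : {pred subvs_of (rel_cycles X A k)} :=
  fun z => vsval z \in rel_boundaries X A k.

Lemma cycle_is_boundary_zmod X A k : zmod_closed (@cycle_is_boundary X A k).
Proof.
split=> [|y z yB zB]; rewrite unfold_in /cycle_is_boundary.
  by rewrite linear0 mem0v.
by rewrite linearB; apply: rpredB.
Qed.

HB.instance Definition _ X A k :=
  GRing.isZmodClosed.Build (subvs_of (rel_cycles X A k))
    (@cycle_is_boundary X A k) (@cycle_is_boundary_zmod X A k).

(* ker / im, as the quotient of the additive group of relative cycles. *)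
Definition rel_homology X A k : zmodType :=
  Quotient.quot (@cycle_is_boundary X A k).

End RelativeHomology.

(* Main.v *)
Require Import Defs.
From mathcomp Require Import all_boot all_order all_algebra.
From mathcomp Require Import polyrcf complex.
From mathcomp Require Import reals ring lra.

(** The relative Laplacian L of (X, A) is the Gram operator of the relative
boundary and coboundary maps, so for a chain phi, seen as a function on all
vertex sets that vanishes off the relative k-cells,
<L phi, phi> = |d phi|^2 + |rel. boundary of phi|^2.  The lower bound on mu_k
is a lower bound on this energy.

Each k-set t carries a function on vertices, its link cochain
phi_t(v) = +-phi(v |: t), the sign being the one with which t occurs in the
boundary of v |: t.  Hence the sum of the values of phi_t is the absolute
boundary of phi at t, and the squares of all the phi_t add up to
(k+1) |phi|^2.  Expanding |d phi|^2 gives the number of cofaces times phi^2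
on the diagonal, and off the diagonal the products -phi_t(v) phi_t(w) over
the v, w such that t, v, w together span a face.  Because X is flag, this
last condition says that v and w are adjacent in the graph G of X', so the
off-diagonal part is that of the sum over t of the Dirichlet energies of the
phi_t on G ([sum_dirichlet_link]).  The diagonals differ, on a cell s, by the
sum of the degrees of the vertices of s minus the number of cofaces of s.  A
vertex of X' is adjacent to at most k vertices of s, unless it spans a coface
with s, so this difference is at most k n' ([degree_count]).

The Poincare inequality on G ([lambda2_poincare]) bounds each Dirichlet
energy from below by lambda_2 (|phi_t|^2 - (sum phi_t)^2 / n').  In total,
|d phi|^2 >= ((k+1) lambda_2 - k n') |phi|^2 - (lambda_2 / n') |boundary|^2,
and lambda_2 <= n' lets the absolute boundary absorb the last term.

Passing to the relative boundary loses the values at the faces t of A of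
dimension k-1.  Such a t has at most one coface, so the square of the boundary
at t is the square of a single value of phi, and the loss is at most the
maximal number of facets in A times |phi|^2 ([boundary_energy_ge]).

If the bound is positive then L is invertible, and a relative cycle is a
relative boundary by the finite dimensional Hodge argument ([hodge_exact]),
since the relative boundary maps compose to zero. *)

Set Implicit Arguments.
Unset Strict Implicit.
Unset Printing Implicit Defensive.

Import Order.TTheory GRing.Theory Num.Theory.
Local Open Scope ring_scope.

(** * Spectra of real symmetric matrices *)

Section Spectrum.
Variable R : rcfType.

Lemma flatten_nseq_sorted (m : R -> nat) (s : seq R) :
  sorted <%R s -> sorted <=%R (flatten [seq nseq (m x) x | x <- s]).
Proof.
elim: s => //= x s IHs ps.
have xs : all (fun y => x <= y) (flatten [seq nseq (m x) x | x <- s]).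
  apply/allP=> y /flattenP[_ /mapP[z zs ->] /nseqP[-> _]].
  by apply: ltW; move/allP: (order_path_min lt_trans ps); apply.
elim: (m x) => [|j IHj] /=; first exact: IHs (path_sorted ps).
rewrite path_min_sorted //; apply/allP=> y; rewrite mem_cat.
by case/orP=> [/nseqP[-> _]|/(allP xs)].
Qed.

Lemma sorted_eigenvalues n (M : 'M[R]_n) : sorted <=%R (eigenvalues M).
Proof. exact/flatten_nseq_sorted/sorted_roots. Qed.

Lemma mem_rootsR (p : {poly R}) x : p != 0 -> (x \in rootsR p) = root p x.
Proof. by move=> p0; rewrite -(roots_on_rootsR p0). Qed.

Lemma count_eigenvalues n (M : 'M[R]_n) x :
  count_mem x (eigenvalues M) = mup x (char_poly M).
Proof.
have p0 : char_poly M != 0 by rewrite monic_neq0 ?char_poly_monic.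
rewrite /eigenvalues count_flatten -map_comp sumnE big_map.
have [xr|xNr] := boolP (root (char_poly M) x); last first.
  rewrite mupNroot // big1_seq // => y /andP[_]; rewrite mem_rootsR //= => yr.
  rewrite count_nseq /=; case: eqP => [yx|_]; last by rewrite mul0n.
  by rewrite -yx yr in xNr.
rewrite (bigD1_seq x) ?mem_rootsR //=; last exact: uniq_roots.
rewrite count_nseq /= eqxx mul1n big1 ?addn0 // => y yx.
by rewrite count_nseq /= (negPf yx) mul0n.
Qed.

(** Conjugating by U commutes with subtracting from the scalar matrix 'X, and
det V * det U = 1. *)
Lemma char_poly_conj (F : comNzRingType) n (V D U : 'M[F]_n) :
  V *m U = 1%:M -> char_poly (V *m D *m U) = char_poly D.
Proof.
move=> VU; have VUp : map_mx polyC V *m map_mx polyC U = 1%:M.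
  by rewrite -map_mxM VU map_mx1.
rewrite /char_poly -[in RHS](mul1r (\det _)) -(det1 {poly F} n) -VUp.
rewrite det_mulmx mulrAC -!det_mulmx /char_poly_mx; congr (\det _).
rewrite mulmxBr mulmxBl !map_mxM; congr (_ - _).
by rewrite scalar_mxC -mulmxA VUp mulmx1.
Qed.

Lemma normsq_ge0 n (f : 'cV[R]_n) : 0 <= (f^T *m f) 0 0.
Proof. by rewrite !mxE sumr_ge0 // => i _; rewrite !mxE -expr2 sqr_ge0. Qed.

Lemma normsq_eq0 n (f : 'cV[R]_n) : ((f^T *m f) 0 0 == 0) = (f == 0).
Proof.
apply/idP/eqP => [|->]; last by rewrite mulmx0 mxE.
rewrite mxE psumr_eq0 => [/allP f0|i _]; last by rewrite !mxE -expr2 sqr_ge0.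
apply/colP=> i; have := f0 i (mem_index_enum _).
by rewrite !mxE -expr2 sqrf_eq0 => /eqP.
Qed.

Lemma eigenvalue_rayleigh n (M : 'M[R]_n) x : x \in eigenvalues M ->
  exists2 f : 'cV_n, 0 < (f^T *m f) 0 0
    & (f^T *m (M *m f)) 0 0 = x * (f^T *m f) 0 0.
Proof.
have p0 : char_poly M != 0 by rewrite monic_neq0 ?char_poly_monic.
case/flattenP=> _ /mapP[y yr ->] /nseqP[-> _].
move: yr; rewrite mem_rootsR // -eigenvalue_root_char => /eigenvalueP[v vM v0].
exists v^T; last by rewrite trmxK mulmxA vM -scalemxAl mxE.
by rewrite lt_def normsq_ge0 andbT normsq_eq0 trmx_eq0.
Qed.

End Spectrum.

(** Diagonalization takes place over an algebraically closed field C whose real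
elements are the copy toC of R.  Keeping C abstract avoids mixing the several
ring structures carried by R[i]; the results are transferred to R afterwards.
*)
Section Spectral.
Variables (R : rcfType) (C : numClosedFieldType) (toC : {rmorphism R -> C}).
Hypothesis toC_le : {mono toC : x y / x <= y}.
Hypothesis toC_onto : forall z, z \is Num.real -> exists x, z = toC x.
Local Open Scope sesquilinear_scope.

(** The coordinates of a real vector in the eigenbasis given by the rows of U,
up to conjugation. *)
Definition coords n (U : 'M[C]_n) (f : 'cV[R]_n) (i : 'I_n) : C :=
  (U *m map_mx toC f) i 0.

Lemma toC_real x : toC x \is Num.real.
Proof. by rewrite realE -(rmorph0 toC) !toC_le -realE num_real. Qed.

Lemma conj_toC x : (toC x)^* = toC x.
Proof. exact/CrealP/toC_real. Qed.

Lemma trmxC_map_toC m n (g : 'M[R]_(m, n)) :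
  (map_mx toC g)^t* = map_mx toC g^T.
Proof. by apply/matrixP=> i j; rewrite !mxE conj_toC. Qed.

(** A real symmetric matrix is Hermitian over C, so it has a unitary eigenbasis
with real eigenvalues, and the multiset of these is read off the
characteristic polynomial.  Only real inner products are recorded: the vectors
of the basis may have complex entries. *)
Lemma symmetric_spectral n (M : 'M[R]_n) : M^T = M ->
  exists r : 'rV[R]_n, exists U : 'M[C]_n,
  [/\ perm_eq (eigenvalues M) [seq r 0 i | i : 'I_n],
      forall f g : 'cV_n, toC ((g^T *m f) 0 0)
                   = \sum_i (coords U g i)^* * coords U f i
    & forall (f : 'cV_n) i, coords U (M *m f) i = toC (r 0 i) * coords U f i].
Proof.
move=> Msym; pose A := map_mx toC M.
have Aherm : A \is hermsymmx.
  apply: realsym_hermsym.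
    apply/is_hermitianmxP; rewrite expr0 scale1r map_mx_id //.
    by apply/matrixP=> i j; rewrite !mxE -[in LHS]Msym mxE.
  by apply/mxOverP=> i j; rewrite mxE toC_real.
pose U := spectralmx A.
have UU : U^t* *m U = 1%:M.
  by rewrite -invmx_unitary ?spectral_unitarymx // mulVmx ?spectral_unit.
have /fin_all_exists[r0 r0E] : forall i, exists x, spectral_diag A 0 i = toC x.
  by move=> i; apply/toC_onto/mxOverP/hermitian_spectral_diag_real.
pose r : 'rV[R]_n := \row_i r0 i.
have rE : spectral_diag A = map_mx toC r.
  by apply/rowP=> i; rewrite !mxE r0E.
have AE : A = U^t* *m diag_mx (map_mx toC r) *m U.
  rewrite -rE -invmx_unitary ?spectral_unitarymx //.
  exact/orthomx_spectralP/hermitian_normalmx.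
exists r, U; split=> [|f g|f i].
- have cp : map_poly toC (char_poly M)
      = map_poly toC (\prod_(x <- [seq r 0 i | i : 'I_n]) ('X - x%:P)).
    rewrite map_char_poly -/A AE char_poly_conj //.
    rewrite char_poly_trig ?diag_mx_is_trig // rmorph_prod big_image /=.
    apply: eq_bigr => i _.
    by rewrite rmorphB /= map_polyX map_polyC /= !mxE eqxx mulr1n.
  apply/allP=> x _ /=; rewrite count_eigenvalues.
  by rewrite (map_poly_inj _ cp) mu_prod_XsubC.
- have -> : toC ((g^T *m f) 0 0) = map_mx toC (g^T *m f) 0 0.
    by rewrite [RHS]mxE.
  have -> : map_mx toC (g^T *m f)
      = (U *m map_mx toC g)^t* *m (U *m map_mx toC f).
    rewrite map_mxM /= trmx_mul map_mxM trmxC_map_toC -!mulmxA.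
    by rewrite [U^t* *m _]mulmxA UU mul1mx.
  by rewrite [LHS]mxE; apply: eq_bigr => j _; rewrite /coords !mxE.
- rewrite /coords map_mxM -/A AE !mulmxA -invmx_unitary ?spectral_unitarymx //.
  by rewrite mulmxV ?spectral_unit // mul1mx -mulmxA mul_diag_mx !mxE.
Qed.

Lemma size_symmetric_spectrum n (M : 'M[R]_n) : M^T = M -> size (eigenvalues M) = n.
Proof.
move=> /symmetric_spectral[r [U [/perm_size -> _ _]]].
by rewrite size_image card_ord.
Qed.

(** If the second eigenvalue is positive, then at most one eigenvalue of the
eigenbasis lies below it.  This must be the eigenvalue 0 of u, so u is a
multiple of the corresponding basis vector, and a vector f orthogonal to u has
no component along it: all the eigenvalues that f sees are at least the second
one. *)
Lemma second_eigenvalue_gap_over n (M : 'M[R]_n) (u f : 'cV[R]_n) :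
  M^T = M -> u != 0 -> M *m u = 0 ->
  0 < nth 0 (eigenvalues M) 1 -> (u^T *m f) 0 0 = 0 ->
  nth 0 (eigenvalues M) 1 * (f^T *m f) 0 0 <= (f^T *m (M *m f)) 0 0.
Proof.
move=> Msym u0 Mu; set l := nth 0 _ 1 => l_gt0 uf.
have [r [U [eig dot act]]] := symmetric_spectral Msym.
have small_le1 : (#|[set i | (r 0 i < l)%R]| <= 1)%N.
  have -> : #|[set i | r 0 i < l]|
          = count (fun x => x < l) [seq r 0 i | i : 'I_n].
    by rewrite cardsE cardE count_map -size_filter enumT.
  rewrite -(permP eig); rewrite /l.
  have := sorted_eigenvalues M.
  case: (eigenvalues M) => [|a [|b s]] //= => [_|]; first by case: (_ < _).
  case/andP=> _ ps; rewrite ltxx add0n.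
  suff -> : count (< b) s = 0%N by case: (_ < _).
  apply/eqP; rewrite -leqn0 leqNgt -has_count; apply/hasPn=> y ys /=.
  by rewrite -leNgt; move/allP: (order_path_min le_trans ps); apply.
have /exists_inP[i0 _ ui0] : [exists i0 in 'I_n, coords U u i0 != 0].
  apply: contraNT u0; rewrite negb_exists_in => /forall_inP cu0.
  rewrite -normsq_eq0; apply/eqP/(fmorph_inj toC).
  rewrite dot rmorph0 big1 // => i _.
  by move: (cu0 i isT); rewrite negbK => /eqP->; rewrite mulr0.
(* The coordinates of u are supported on eigenvalue 0, which is below l. *)
have ri0 i : coords U u i != 0 -> r 0 i = 0.
  move=> ui; have := act u i; rewrite Mu /coords map_mx0 mulmx0 mxE.
  by move=> /esym/eqP; rewrite mulf_eq0 (negPf ui) orbF fmorph_eq0 => /eqP.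
have big_i i : i != i0 -> l <= r 0 i.
  move=> ii0; rewrite leNgt; apply/negP=> ri.
  move: small_le1; rewrite leqNgt (cardD1 i) (cardD1 i0) !inE ri eq_sym ii0 /=.
  by rewrite ri0 // l_gt0.
have fi0 : coords U f i0 = 0.
  have := dot f u; rewrite uf rmorph0 (bigD1 i0) //=.
  rewrite big1 ?addr0 => [/esym/eqP|i ii0].
    by rewrite mulf_eq0 conjC_eq0 (negPf ui0) => /eqP.
  have [->|/ri0 ri] := eqVneq (coords U u i) 0; first by rewrite conjC0 mul0r.
  by have := big_i i ii0; rewrite ri leNgt l_gt0.
rewrite -toC_le rmorphM !dot mulr_sumr; apply: ler_sum => i _; rewrite act.
have [->|/big_i lr] := eqVneq i i0; first by rewrite fi0 !mulr0.
by rewrite [leRHS]mulrCA ler_wpM2r ?toC_le // mulrC -normCK exprn_ge0.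
Qed.

End Spectral.

Section Complex.
Variable R : rcfType.

Lemma size_eigenvalues n (M : 'M[R]_n) : M^T = M -> size (eigenvalues M) = n.
Proof.
apply: (@size_symmetric_spectrum R R[i] (real_complex R));
  last by move=> z /complex_realP.
move=> x y; exact: lecR.
Qed.

Lemma second_eigenvalue_gap n (M : 'M[R]_n) (u f : 'cV[R]_n) :
  M^T = M -> u != 0 -> M *m u = 0 ->
  0 < nth 0 (eigenvalues M) 1 -> (u^T *m f) 0 0 = 0 ->
  nth 0 (eigenvalues M) 1 * (f^T *m f) 0 0 <= (f^T *m (M *m f)) 0 0.
Proof.
apply: (@second_eigenvalue_gap_over R R[i] (real_complex R));
  last by move=> z /complex_realP.
move=> x y; exact: lecR.
Qed.

End Complex.

(** * The Poincare inequality on a graph *)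

Section GraphGap.
Variables (R : rcfType) (T : finType) (G : sgraph T).
Implicit Types f : T -> R.
Local Notation V := (vset G).
Local Notation n := #|vset G|.

(** The quadratic form of the graph Laplacian. *)
Definition dirichlet f : R :=
  \sum_(v in V) (gdeg G v)%:R * f v ^+ 2
  - \sum_(v in V) \sum_(w in V) (adj G v w)%:R * (f v * f w).

Lemma gdegE v : (gdeg G v)%:R = \sum_(w in V) (adj G v w)%:R :> R.
Proof.
rewrite /gdeg -sum1_card natr_sum big_mkcond [RHS]big_mkcond /=.
by apply: eq_bigr => w _; rewrite inE; case: (w \in V); case: (adj G v w).
Qed.

Lemma dirichletE f : 2 * dirichlet f =
  \sum_(v in V) \sum_(w in V) (adj G v w)%:R * (f v - f w) ^+ 2.
Proof.
have deg1 : \sum_(v in V) (gdeg G v)%:R * f v ^+ 2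
          = \sum_(v in V) \sum_(w in V) (adj G v w)%:R * f v ^+ 2.
  by apply: eq_bigr => v _; rewrite gdegE mulr_suml.
have deg2 : \sum_(v in V) (gdeg G v)%:R * f v ^+ 2
          = \sum_(v in V) \sum_(w in V) (adj G v w)%:R * f w ^+ 2.
  rewrite deg1 exchange_big /=; apply: eq_bigr => v _; apply: eq_bigr => w _.
  by rewrite adj_sym.
rewrite /dirichlet mulrBr mulr_natl mulr2n {1}deg1 deg2 mulr_sumr.
rewrite -big_split -sumrB; apply: eq_bigr => v _ /=.
rewrite mulr_sumr -big_split -sumrB; apply: eq_bigr => w _ /=.
ring.
Qed.

Lemma sum_sqr_dist f :
  \sum_(v in V) \sum_(w in V) (f v - f w) ^+ 2
  = 2 * (n%:R * \sum_(v in V) f v ^+ 2 - (\sum_(v in V) f v) ^+ 2).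
Proof.
set S := \sum_(v in V) f v; set N := \sum_(v in V) f v ^+ 2.
have rowE v : \sum_(w in V) (f v - f w) ^+ 2 = n%:R * f v ^+ 2 + N - 2 * S * f v.
  have -> : \sum_(w in V) (f v - f w) ^+ 2
          = \sum_(w in V) (f v ^+ 2 + f w ^+ 2 - 2 * f v * f w).
    by apply: eq_bigr => w _; ring.
  rewrite sumrB big_split /= sumr_const -mulr_sumr -/S -/N; ring.
under eq_bigr do rewrite rowE.
rewrite sumrB big_split /= sumr_const -!mulr_sumr -/S -/N; ring.
Qed.

Lemma dirichlet_ge0 f : 0 <= dirichlet f.
Proof.
rewrite -(pmulr_rge0 _ (ltr0n R 2)) dirichletE.
by do 2!(apply: sumr_ge0 => ? _); rewrite mulr_ge0 ?ler0n ?sqr_ge0.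
Qed.

(** The right-hand side is the Dirichlet energy on the complete graph, which
adds the nonedges of G. *)
Lemma dirichlet_le f :
  dirichlet f <= n%:R * \sum_(v in V) f v ^+ 2 - (\sum_(v in V) f v) ^+ 2.
Proof.
rewrite -(ler_pM2l (ltr0n R 2)) dirichletE -sum_sqr_dist.
do 2!(apply: ler_sum => ? _); rewrite ler_piMl ?sqr_ge0 //.
by case: adj.
Qed.

Definition vcol f : 'cV[R]_n := \col_i f (enum_val i).

Lemma vcol_dot f g : ((vcol f)^T *m vcol g) 0 0 = \sum_(v in V) f v * g v.
Proof.
by rewrite mxE [RHS]big_enum_val; apply: eq_bigr => i _; rewrite !mxE.
Qed.

Lemma vcol_onto (u : 'cV_n) : exists f, u = vcol f.
Proof.
exists (fun v => \sum_(i | enum_val i == v) u i 0).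
apply/colP=> i; rewrite mxE (big_pred1 i) // => j.
by rewrite (inj_eq enum_val_inj).
Qed.

Lemma laplacian_act f : graph_laplacian R G *m vcol f =
  vcol (fun v => (gdeg G v)%:R * f v - \sum_(w in V) (adj G v w)%:R * f w).
Proof.
apply/colP=> i; rewrite mulmxBl mul_diag_mx !mxE; congr (_ - _).
by rewrite [RHS]big_enum_val; apply: eq_bigr => j _; rewrite !mxE.
Qed.

Lemma laplacian_quad f :
  ((vcol f)^T *m (graph_laplacian R G *m vcol f)) 0 0 = dirichlet f.
Proof.
rewrite laplacian_act vcol_dot /dirichlet -sumrB; apply: eq_bigr => v _.
rewrite mulrBr mulr_sumr; congr (_ - _); first by ring.
by apply: eq_bigr => w _; ring.
Qed.

Lemma laplacian_sym : (graph_laplacian R G)^T = graph_laplacian R G.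
Proof.
rewrite /graph_laplacian linearB /= tr_diag_mx; congr (_ - _).
by apply/matrixP=> i j; rewrite !mxE adj_sym.
Qed.

Hypothesis n_gt1 : (1 < n)%N.

(** The Laplacian of a graph on n vertices is dominated by that of the complete
graph, hence by n. *)
Lemma lambda2_le_card : lambda2 R G <= n%:R.
Proof.
have /eigenvalue_rayleigh[u] : lambda2 R G \in eigenvalues (graph_laplacian R G).
  by rewrite mem_nth // size_eigenvalues ?laplacian_sym.
have [f ->] := vcol_onto u; rewrite laplacian_quad vcol_dot => f_gt0 fE.
rewrite -(ler_pM2r f_gt0) -fE (le_trans (dirichlet_le f)) // gerBl.
by rewrite sqr_ge0.
Qed.

(** Subtracting its mean from f changes neither the differences of f nor its
Dirichlet energy, and makes f orthogonal to the constants, which are in the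
kernel of the Laplacian; if lambda_2 is positive, the spectral gap applies.
Otherwise the left-hand side is not positive, and the right-hand side is always
nonnegative. *)
Lemma lambda2_poincare f :
  lambda2 R G * (\sum_(v in V) f v ^+ 2 - n%:R^-1 * (\sum_(v in V) f v) ^+ 2)
  <= dirichlet f.
Proof.
have n_gt0 : 0 < n%:R :> R by rewrite ltr0n ltnW.
set S := \sum_(v in V) f v; set N := \sum_(v in V) f v ^+ 2.
pose g v := f v - n%:R^-1 * S.
have Sg : \sum_(v in V) g v = 0.
  rewrite sumrB sumr_const -/S -(mulr_natl (_ * S)) mulVKf ?subrr //.
  exact: lt0r_neq0.
have Ng : \sum_(v in V) g v * g v = N - n%:R^-1 * S ^+ 2.
  have -> : \sum_(v in V) g v * g v
          = \sum_(v in V) (f v ^+ 2 - n%:R^-1 * S * f v - n%:R^-1 * S * g v).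
    by apply: eq_bigr => v _; rewrite /g; ring.
  rewrite !sumrB -!mulr_sumr Sg -/S -/N; ring.
have Dg : dirichlet f = dirichlet g.
  apply: (mulfI (lt0r_neq0 (ltr0n R 2))); rewrite !dirichletE.
  by apply: eq_bigr => v _; apply: eq_bigr => w _; rewrite /g; ring.
rewrite -Ng Dg; case: (lerP (lambda2 R G) 0) => [l_le0|l_gt0].
  rewrite (le_trans _ (dirichlet_ge0 g)) // mulr_le0_ge0 //.
  by rewrite sumr_ge0 // => v _; rewrite -expr2 sqr_ge0.
rewrite -laplacian_quad -vcol_dot.
apply: (@second_eigenvalue_gap _ _ _ (vcol (fun=> 1))); rewrite ?laplacian_sym //.
- rewrite -normsq_eq0 vcol_dot sumr_const mulr1; exact: lt0r_neq0.
- rewrite laplacian_act; apply/colP=> i; rewrite !mxE gdegE mulr1.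
  under [X in _ - X]eq_bigr do rewrite mulr1.
  exact: subrr.
- by rewrite vcol_dot -[RHS]Sg; apply: eq_bigr => v _; rewrite mul1r.
Qed.

End GraphGap.

Lemma dirichlet_full (R : rcfType) (T : finType) (G : sgraph T) (f : T -> R) :
  (forall v, v \notin vset G -> f v = 0) ->
  dirichlet G f = \sum_v (gdeg G v)%:R * f v ^+ 2
    - \sum_v \sum_w (adj G v w)%:R * (f v * f w).
Proof.
move=> f0; rewrite /dirichlet; congr (_ - _); rewrite big_mkcond.
  apply: eq_bigr => v _; case: ifPn => // /f0 ->.
  by rewrite expr0n mulr0.
apply: eq_bigr => v _; case: ifPn => [_|/f0 fv]; last first.
  by rewrite big1 // => w _; rewrite fv mul0r mulr0.
rewrite big_mkcond; apply: eq_bigr => w _; case: ifPn => // /f0 ->.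
by rewrite !mulr0.
Qed.

(** * Boundary and coboundary of functions on vertex sets *)

(** Chains are functions on all vertex sets, vanishing off the relevant cells;
this removes the conditions on faces from the sums. *)
Section Cochains.
Variables (R : rcfType) (d : Order.disp_t) (T : finOrderType d).
Implicit Types (s t e : {set T}) (u v w : T) (phi : {set T} -> R).

Lemma vposD1 e v w : w \in e -> vpos e v = ((w < v)%O + vpos (e :\ w) v)%N.
Proof.
move=> we; rewrite /vpos (cardsD1 w) !inE we; congr (_ + _)%N.
by apply: eq_card => u; rewrite !inE andbA.
Qed.

Definition face_sign s v : R := (-1) ^+ vpos s v.

Lemma face_sign_sqr s v : face_sign s v ^+ 2 = 1.
Proof. by rewrite /face_sign sqrr_sign. Qed.

Lemma face_signD1 e v : v \in e -> face_sign e v = face_sign (e :\ v) v.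
Proof. by move=> ve; rewrite /face_sign (vposD1 v ve) ltxx. Qed.

(** Removing the smaller of two vertices shifts the position of the larger one,
and not conversely. *)
Lemma face_sign_swap e v w : v \in e -> w \in e -> v != w ->
  face_sign e v * face_sign (e :\ v) w
  = - (face_sign e w * face_sign (e :\ w) v).
Proof.
move=> ve we; rewrite /face_sign (vposD1 v we) (vposD1 w ve) !exprD.
case: ltgtP => // _ _; rewrite expr0 expr1; ring.
Qed.

Lemma face_sign_mul e v w : v \in e -> w \in e -> v != w ->
  face_sign e v * face_sign e w
  = - (face_sign (e :\ v) w * face_sign (e :\ w) v).
Proof.
move=> ve we; rewrite /face_sign (vposD1 v we) (vposD1 w ve) !exprD.
case: ltgtP => // _ _; rewrite expr0 expr1; ring.
Qed.

Definition coboundary phi e : R := \sum_(v in e) face_sign e v * phi (e :\ v).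

(** The function that phi induces on the link of t; the sign is the coefficient
of t in the boundary of v |: t. *)
Definition link_cochain phi t v : R :=
  if v \in t then 0 else face_sign t v * phi (v |: t).

Definition boundary phi t : R := \sum_v link_cochain phi t v.

(** Both sides sum over the pairs of a set and a set of one element less. *)
Lemma sum_flag (F : {set T} -> T -> R) :
  \sum_(s : {set T}) \sum_(v in s) F s v = \sum_(t : {set T}) \sum_(v | v \notin t) F (v |: t) v.
Proof.
rewrite (exchange_big_dep predT) //= [RHS](exchange_big_dep predT) //=.
apply: eq_bigr => v _.
rewrite (reindex_onto (fun t => v |: t) (fun s => s :\ v)) /=; last first.
  by move=> s; apply: setD1K.
apply: eq_bigl => t; rewrite setU11 /=.
apply/eqP/idP => [<-|]; first by rewrite setD11.
exact: setU1K.
Qed.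

Lemma link_cochain_sqr phi t v : v \notin t ->
  link_cochain phi t v ^+ 2 = phi (v |: t) ^+ 2.
Proof.
by move=> /negPf vt; rewrite /link_cochain vt exprMn face_sign_sqr mul1r.
Qed.

Lemma sum_link_sqr phi (F : {set T} -> T -> R) :
  \sum_(t : {set T}) \sum_v F t v * link_cochain phi t v ^+ 2
  = \sum_(s : {set T}) (\sum_(v in s) F (s :\ v) v) * phi s ^+ 2.
Proof.
transitivity (\sum_(s : {set T}) \sum_(v in s) F (s :\ v) v * phi s ^+ 2); last first.
  by apply: eq_bigr => s _; rewrite mulr_suml.
rewrite sum_flag; apply: eq_bigr => t _.
rewrite [RHS]big_mkcond; apply: eq_bigr => v _ /=.
have [vt|vt] := boolP (v \in t); last by rewrite setU1K // link_cochain_sqr.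
by rewrite /link_cochain vt expr0n mulr0.
Qed.

(** Two facets of e meet in the set t = e minus v, w.  The product of the
signs of the two facets in e is minus the product of the signs of t in the two
facets, so each cross term is minus a product of values of the link cochain of
t. *)
Lemma coboundary_sqr phi e :
  coboundary phi e ^+ 2 = \sum_(v in e) phi (e :\ v) ^+ 2
  - \sum_(v in e) \sum_(w in e :\ v)
      link_cochain phi (e :\ v :\ w) v * link_cochain phi (e :\ v :\ w) w.
Proof.
rewrite expr2 {1}/coboundary mulr_suml -sumrB; apply: eq_bigr => v ve.
rewrite /coboundary mulr_sumr (bigD1 v) //= mulrACA -expr2 face_sign_sqr mul1r.
congr (_ + _); rewrite -sumrN; apply: eq_big => [w|w /andP[we wv]].
  by rewrite !inE andbC.
have wev : w \in e :\ v by rewrite !inE wv.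
set t := e :\ v :\ w.
have wt : w \notin t by rewrite !inE eqxx.
have vt : v \notin t by rewrite !inE eqxx andbF.
have tC : t = e :\ w :\ v by rewrite /t !setDDl (setUC [set v]).
have vew : v \in e :\ w by rewrite !inE eq_sym wv.
rewrite /link_cochain (negPf vt) (negPf wt) [w |: _](setD1K wev) {1 2}tC.
rewrite [v |: _](setD1K vew) -face_signD1 // /t -face_signD1 // mulrACA.
rewrite face_sign_mul // 1?eq_sym //; ring.
Qed.

(** Summing over e, the diagonal terms are grouped by the facet s, and the cross
terms by the common face t of two facets of e. *)
Lemma coboundary_energy phi (P : pred {set T}) :
  \sum_(e | P e) coboundary phi e ^+ 2
  = \sum_(s : {set T}) #|[set v | (v \notin s) && P (v |: s)]|%:R * phi s ^+ 2
  - \sum_(t : {set T}) \sum_v \sum_w ((v != w) && P (v |: (w |: t)))%:R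
      * (link_cochain phi t v * link_cochain phi t w).
Proof.
under eq_bigr do rewrite coboundary_sqr.
rewrite sumrB; congr (_ - _).
  rewrite big_mkcond (eq_bigr (fun e => \sum_(v in e) (P e)%:R * phi (e :\ v) ^+ 2)).
    rewrite sum_flag; apply: eq_bigr => t _.
    rewrite -sum1_card natr_sum mulr_suml big_mkcond [RHS]big_mkcond.
    apply: eq_bigr => v _; rewrite !inE.
    by case: ifP => // vt; rewrite setU1K // ; case: (P _); rewrite ?mul0r.
  by move=> e _; rewrite -mulr_sumr; case: (P e); rewrite ?mul1r ?mul0r.
pose H e v w t := (P e)%:R * (link_cochain phi t v * link_cochain phi t w).
transitivity (\sum_(e : {set T}) \sum_(v in e) \sum_(w in e :\ v) H e v w (e :\ v :\ w)).
  rewrite big_mkcond; apply: eq_bigr => e _ /=; rewrite /H.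
  case: (P e); first by do 2!(apply: eq_bigr => ? _); rewrite mul1r.
  by rewrite big1 // => v _; rewrite big1 // => w _; rewrite mul0r.
rewrite sum_flag.
transitivity (\sum_(s : {set T}) \sum_(w in s) \sum_(v | v \notin s) H (v |: s) v w (s :\ w)).
  apply: eq_bigr => s _; rewrite [RHS]exchange_big; apply: eq_bigr => v vs /=.
  by rewrite setU1K.
rewrite sum_flag; apply: eq_bigr => t _; rewrite [RHS]exchange_big.
rewrite big_mkcond; apply: eq_bigr => w _; rewrite big_mkcond.
case: ifP => [wt|/negbFE wt].
  apply: eq_bigr => v _; rewrite setU1K // !inE negb_or /H.
  case: (v != w) => /=; last by rewrite mul0r.
  case: ifP => //= /negbFE vt.
  by rewrite /link_cochain vt !mul0r mulr0.
rewrite big1 // => v _; rewrite /link_cochain wt !mulr0 //.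
Qed.

End Cochains.

(** * Flag complexes and their truncation *)

Section Flag.
Variable T : finType.
Implicit Types (X A : {set {set T}}) (s t : {set T}).

Lemma flag_down X s t : is_flag X -> s \in X -> t \subset s -> t \in X.
Proof.
case=> G ->; rewrite !inE => /andP[sG /forall_inP s_adj] ts.
rewrite (subset_trans ts sG); apply/forall_inP=> u /(subsetP ts) us.
by apply/forall_inP=> v /(subsetP ts); move: v; apply/forall_inP/s_adj.
Qed.

Lemma flag_clique X s : is_flag X ->
  (forall u v, u \in s -> v \in s -> [set u; v] \in X) -> s \in X.
Proof.
case=> G -> clique; rewrite inE; apply/andP; split.
  apply/subsetP=> u us; have := clique u u us us.
  by rewrite inE => /andP[/subsetP/(_ u)]; rewrite set21 => ->.
apply/forall_inP=> u us; apply/forall_inP=> v vs; apply/implyP=> uv.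
have := clique u v us vs; rewrite inE => /andP[_ /forall_inP/(_ u)].
by rewrite set21 => /(_ isT)/forall_inP/(_ v); rewrite set22 uv; apply.
Qed.

Lemma trunc_sub X A k : is_flag X -> trunc_complex X A k \subset X.
Proof.
move=> fX; apply/subsetP=> s; rewrite inE => /exists_inP[t tX st].
by apply: flag_down st => //; move: tX; rewrite !inE => /orP[/andP[_ /andP[]]|/andP[]].
Qed.

Lemma trunc_down X A k s t :
  s \in trunc_complex X A k -> t \subset s -> t \in trunc_complex X A k.
Proof.
rewrite !inE => /exists_inP[e eX se] ts; apply/exists_inP; exists e => //.
exact: subset_trans ts se.
Qed.

Lemma cell_trunc X A k s : s \in rel_cells X A k -> s \in trunc_complex X A k.
Proof. by move=> sX; rewrite inE; apply/exists_inP; exists s; rewrite // inE sX. Qed.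

Lemma cofaces_trunc X A k s :
  s \in X -> #|s| = k.+2 -> s \in trunc_complex X A k.
Proof.
move=> sX sk; rewrite inE; apply/exists_inP; exists s => //.
by rewrite !inE sX sk leqnn orbT.
Qed.

Lemma cells_faces X A k s : s \in rel_cells X A k -> (s \in X) /\ #|s| = k.+1.
Proof. by rewrite !inE => /andP[_ /andP[-> /eqP]]. Qed.

End Flag.

(** * Energy estimates for relative chains *)

Section RelativeEnergy.
Variables (R : rcfType) (d : Order.disp_t) (T : finOrderType d).
Variables (X A : {set {set T}}) (k : nat).
Hypothesis hX : is_flag X.
Local Notation X' := (trunc_complex X A k).
Local Notation G := (skeleton_graph X').
Local Notation cells := (rel_cells X A k).
Implicit Types (s t e : {set T}) (u v w : T).

(** Flagness enters here: once v |: t and w |: t are faces, only the pair v, w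
has to be checked.  The resulting face has dimension k+1 and so lies in X',
which is why adjacency in X and in X' agree on such pairs. *)
Lemma link_adj t v w : v \notin t -> w \notin t ->
  v |: t \in cells -> w |: t \in cells ->
  adj G v w = (v != w) && (v |: (w |: t) \in X).
Proof.
move=> vt wt vtC wtC; rewrite /= /skel_adj; case: (eqVneq v w) => //= vw.
have [vtX vtk] := cells_faces vtC; have [wtX _] := cells_faces wtC.
have tk : #|t| = k by move: vtk; rewrite cardsU1 vt => -[].
apply/idP/idP => [/(subsetP (trunc_sub A k hX)) vwX|vwtX].
  have wvX : [set w; v] \in X by rewrite setUC.
  apply: flag_clique => // a b.
  have pair s : s \in X -> a \in s -> b \in s -> [set a; b] \in X.
    by move=> sX as_ bs; apply: (flag_down hX sX); rewrite subUset !sub1set as_.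
  have [av|av] := boolP (a \in v |: t); have [bv|bv] := boolP (b \in v |: t).
  - by move=> _ _; apply: pair vtX _ _.
  - move: av bv; rewrite !inE => /predU1P[->|at_]; rewrite negb_or => /andP[bv bt].
      by rewrite (negPf bv) (negPf bt) orbF /= => _ /eqP->.
    rewrite (negPf bv) (negPf bt) orbF /= => _ /eqP bw.
    by apply: pair wtX _ _; rewrite !inE ?bw ?eqxx ?at_ ?orbT.
  - move: av bv; rewrite !inE negb_or => /andP[av at_] /predU1P[->|bt].
      by rewrite (negPf av) (negPf at_) orbF /= => /eqP->.
    rewrite (negPf av) (negPf at_) orbF /= => /eqP aw _.
    by apply: pair wtX _ _; rewrite !inE ?aw ?eqxx ?bt ?orbT.
  - move: av bv; rewrite !inE !negb_or => /andP[av at_] /andP[bv bt].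
    rewrite (negPf av) (negPf at_) (negPf bv) (negPf bt) !orbF /= => aw bw.
    by apply: pair wtX _ _; rewrite !inE ?aw ?bw.
apply: trunc_down (cofaces_trunc _ vwtX _) _.
  by rewrite cardsU1 !inE negb_or vw vt cardsU1 wt tk.
by rewrite subUset !sub1set !inE !eqxx !orbT.
Qed.

Lemma cell_vertices s : s \in cells -> s \subset vset G.
Proof. by move=> /cell_trunc sX'; apply: bigcup_sup sX'. Qed.

(** Counting the adjacent pairs by their vertex u: a vertex of s misses itself,
and a vertex outside s adjacent to all of s forms a coface with s by
flagness. *)
Lemma degree_count s : s \in cells ->
  (\sum_(v in s) gdeg G v
   <= #|[set u | (u \notin s) && (u |: s \in X)]| + k * #|vertices X'|)%N.
Proof.
move=> sC; have [sX sk] := cells_faces sC.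
have -> : (\sum_(v in s) gdeg G v
           = \sum_(u in vset G) #|[set v in s | adj G v u]|)%N.
  transitivity (\sum_(v in s) \sum_(u in vset G) adj G v u)%N.
    apply: eq_bigr => v _; rewrite /gdeg -sum1_card big_mkcond [RHS]big_mkcond.
    by apply: eq_bigr => u _; rewrite inE; case: (u \in _) => //=; case: skel_adj.
  rewrite exchange_big; apply: eq_bigr => u _ /=.
  rewrite -sum1_card big_mkcond [RHS]big_mkcond.
  by apply: eq_bigr => v _; rewrite inE; case: (v \in _) => //=; case: skel_adj.
apply: (@leq_trans (\sum_(u in vset G) (((u \notin s) && (u |: s \in X)) + k))).
  apply: leq_sum => u uV.
  have [us|us] /= := boolP (u \in s).
    rewrite add0n -ltnS -sk (cardsD1 u s) us ltnS; apply: subset_leq_card.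
    apply/subsetP=> v; rewrite !inE => /andP[vs /andP[vu _]].
    by rewrite vu.
  have [usX|usX] := boolP (u |: s \in X).
    rewrite add1n -sk; apply: subset_leq_card; apply/subsetP=> v.
    by rewrite inE => /andP[].
  rewrite add0n -ltnS -sk; apply: proper_card; rewrite properEneq.
  apply/andP; split; last by apply/subsetP=> v; rewrite inE => /andP[].
  apply: contra usX => /eqP all_adj.
  have uX v : v \in s -> [set u; v] \in X.
    rewrite -all_adj inE => /andP[_ /andP[_ vuX']]; rewrite setUC.
    exact: (subsetP (trunc_sub A k hX)).
  apply: flag_clique => // a b; rewrite !inE => /predU1P[->|as_] /predU1P[->|bs].
  - by rewrite setUid; case/bigcupP: uV => e eX' ue;
      apply: (flag_down hX (subsetP (trunc_sub A k hX) e eX')); rewrite sub1set.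
  - exact: uX.
  - by rewrite setUC; apply: uX.
  - by apply: (flag_down hX sX); rewrite subUset !sub1set as_.
rewrite big_split /= sum_nat_const mulnC leq_add2r -sum1_card.
rewrite big_mkcond [leqRHS]big_mkcond; apply: leq_sum => u _; rewrite inE.
by case: ifP => _; case: ifP => // ->.
Qed.

Variable phi : {set T} -> R.
Hypothesis phi_supp : forall s, s \notin cells -> phi s = 0.

Lemma link_supp t v : v |: t \notin cells -> link_cochain phi t v = 0.
Proof. by move=> vt; rewrite /link_cochain phi_supp // mulr0 if_same. Qed.

Lemma link_vertex t v : v \notin vset G -> link_cochain phi t v = 0.
Proof.
move=> vV; apply: link_supp; apply: contra vV => /cell_vertices/subsetP; apply.
exact: setU11.
Qed.

(** The two energies have the same off-diagonal part by [link_adj], so only their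
diagonals remain: vertex degrees for the first, coface numbers for the second.
*)
Lemma sum_dirichlet_link :
  \sum_(t : {set T}) dirichlet G (link_cochain phi t)
  = \sum_(s : {set T}) (\sum_(v in s) gdeg G v)%:R * phi s ^+ 2
    + \sum_(e in X) coboundary phi e ^+ 2
    - \sum_(s : {set T}) #|[set u | (u \notin s) && (u |: s \in X)]|%:R * phi s ^+ 2.
Proof.
under eq_bigr => t _ do rewrite (dirichlet_full (@link_vertex t)).
rewrite sumrB (@coboundary_energy _ _ _ _ (mem X)) sum_link_sqr.
rewrite addrA addrAC addrK; congr (_ - _).
  by apply: eq_bigr => s _; rewrite natr_sum.
apply: eq_bigr => t _; apply: eq_bigr => v _; apply: eq_bigr => w _.
have [vt|vt] := boolP (v \in t); first by rewrite /link_cochain vt mul0r !mulr0.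
have [wt|wt] := boolP (w \in t); first by rewrite /link_cochain wt !mulr0.
have [vC|/link_supp->] := boolP (v |: t \in cells); last by rewrite mul0r !mulr0.
have [wC|/link_supp->] := boolP (w |: t \in cells); last by rewrite !mulr0.
by rewrite (link_adj vt wt vC wC).
Qed.

Hypothesis A_down : forall s t, s \in A -> t \subset s -> t \in A.

(** A face of A of dimension k+1 has all its facets in A, where phi vanishes, so
the absolute and the relative coboundary have the same energy. *)
Lemma coboundary_supp e : e \in X -> e \notin rel_cells X A k.+1 ->
  coboundary phi e = 0.
Proof.
move=> eX eC; rewrite /coboundary big1 // => v ve.
have [evC|/phi_supp->] := boolP (e :\ v \in cells); last by rewrite mulr0.
have [_ evk] := cells_faces evC.
have ek : #|e| = k.+2 by rewrite (cardsD1 v) ve evk.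
move: eC evC; rewrite !inE eX ek !eqxx !andbT negbK => eA.
by rewrite evk eqxx (A_down eA) ?subD1set.
Qed.

Lemma coboundary_energy_ge :
  (0 < k)%N -> (1 < #|vertices X'|)%N ->
  lambda2 R G * (k.+1%:R * \sum_(s : {set T}) phi s ^+ 2
        - #|vertices X'|%:R^-1 * \sum_(t : {set T}) boundary phi t ^+ 2)
    - k%:R * #|vertices X'|%:R * \sum_(s : {set T}) phi s ^+ 2
  <= \sum_(e in rel_cells X A k.+1) coboundary phi e ^+ 2.
Proof.
move=> k_gt0 n_gt1.
have poinc : lambda2 R G * (k.+1%:R * \sum_(s : {set T}) phi s ^+ 2
        - #|vertices X'|%:R^-1 * \sum_(t : {set T}) boundary phi t ^+ 2)
    <= \sum_(t : {set T}) dirichlet G (link_cochain phi t).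
  have -> : k.+1%:R * \sum_(s : {set T}) phi s ^+ 2
      = \sum_(t : {set T}) \sum_(v in vset G) link_cochain phi t v ^+ 2.
    transitivity (\sum_(t : {set T}) \sum_v 1 * link_cochain phi t v ^+ 2).
      rewrite (sum_link_sqr phi (fun _ _ => 1)) mulr_sumr; apply: eq_bigr => s _.
      have [/cells_faces[_ sk]|/phi_supp->] := boolP (s \in cells).
        by rewrite sumr_const sk.
      by rewrite expr0n !mulr0.
    apply: eq_bigr => t _; rewrite [RHS]big_mkcond; apply: eq_bigr => v _ /=.
    by rewrite mul1r; case: ifPn => // /link_vertex->; rewrite expr0n.
  rewrite mulr_sumr -sumrB mulr_sumr; apply: ler_sum => t _.
  apply: le_trans (lambda2_poincare (G := G) n_gt1 _).
  rewrite le_eqVlt; apply/predU1P; left.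
  congr (_ * (_ - _ * _ ^+ 2)); rewrite /boundary [RHS]big_mkcond.
  by apply: eq_bigr => v _; case: ifPn => // /link_vertex.
have -> : \sum_(e in rel_cells X A k.+1) coboundary phi e ^+ 2
        = \sum_(e in X) coboundary phi e ^+ 2.
  rewrite big_mkcond [RHS]big_mkcond; apply: eq_bigr => e _.
  case: ifPn => [/cells_faces[-> _] //|eC].
  by case: ifP => // eX; rewrite coboundary_supp // expr0n.
have count : \sum_(s : {set T}) (\sum_(v in s) gdeg G v)%:R * phi s ^+ 2
   <= \sum_(s : {set T}) #|[set u | (u \notin s) && (u |: s \in X)]|%:R * phi s ^+ 2
      + k%:R * #|vertices X'|%:R * \sum_(s : {set T}) phi s ^+ 2.
  rewrite mulr_sumr -big_split; apply: ler_sum => s _ /=; rewrite -mulrDl.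
  have [sC|/phi_supp->] := boolP (s \in cells); last by rewrite expr0n !mulr0.
  by rewrite ler_wpM2r ?sqr_ge0 // -natrM -natrD ler_nat degree_count.
move: poinc count; rewrite sum_dirichlet_link; lra.
Qed.

Lemma boundary_supp t : t \notin faces X k.-1 -> (0 < k)%N -> boundary phi t = 0.
Proof.
move=> tX k_gt0; rewrite /boundary big1 // => v _.
have [vt|vt] := boolP (v \in t); first by rewrite /link_cochain vt.
apply: link_supp; apply: contra tX => /cells_faces[vtX vtk].
rewrite inE (flag_down hX vtX) ?subsetUr //=.
by rewrite prednK // -eqSS -vtk cardsU1 vt add1n.
Qed.

Hypothesis deg_A : forall s, s \in faces A k.-1 -> (cdeg X s <= 1)%N.
Local Notation m := (\max_(s in faces X' k) #|subfaces X k.-1 s :&: faces A k.-1|).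

(** As t has at most one coface, at most one value of its link cochain is
nonzero. *)
Lemma boundary_discrete t : t \in faces A k.-1 ->
  boundary phi t ^+ 2 = \sum_v link_cochain phi t v ^+ 2.
Proof.
move=> /deg_A; rewrite leq_eqVlt ltnS leqn0 => degt.
have uniq_v v w : link_cochain phi t v != 0 -> link_cochain phi t w != 0 -> v = w.
  have cofaceP u : link_cochain phi t u != 0 ->
      (u \notin t)
      && (u |: t \in [set e in X | (#|e| == #|t|.+1) && (t \subset e)]).
    have [ut|ut] := boolP (u \in t); first by rewrite /link_cochain ut eqxx.
    have [/cells_faces[uX _] _|/link_supp->] := boolP (u |: t \in cells).
      by rewrite inE uX cardsU1 ut eqxx subsetUr.
    by rewrite eqxx.
  move=> /cofaceP/andP[vt vE] /cofaceP/andP[wt wE].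
  move: degt; rewrite /cdeg => /orP[/cards1P[e eE]|/eqP/cards0_eq e0].
    move: vE wE; rewrite eE !inE => /eqP vte /eqP wte.
    have: v \in w |: t by rewrite wte -vte setU11.
    by rewrite !inE (negPf vt) orbF => /eqP.
  by move: vE; rewrite e0 inE.
have [v v_nz|all0] := pickP (fun v => link_cochain phi t v != 0).
  rewrite /boundary (bigD1 v) //= [RHS](bigD1 v) //= !big1 ?addr0 //.
    move=> w wv; have [->|/uniq_v/(_ v_nz) wE] := eqVneq (link_cochain phi t w) 0.
      by rewrite expr0n.
    by rewrite wE eqxx in wv.
  move=> w wv; apply/eqP/negPn/negP=> /uniq_v/(_ v_nz) wE.
  by rewrite wE eqxx in wv.
have l0 v : link_cochain phi t v = 0 by apply/eqP/negPn/negP; rewrite all0.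
by rewrite /boundary !big1 ?expr0n // => v _; rewrite l0 ?expr0n.
Qed.

(** The relative boundary forgets the values of the boundary at the faces of A;
grouped by cells s, their squares contribute phi s ^+ 2 once for each facet of
s in A. *)
Lemma boundary_energy_ge : (0 < k)%N -> A \subset X ->
  \sum_(t : {set T}) boundary phi t ^+ 2 - m%:R * \sum_(s : {set T}) phi s ^+ 2
  <= \sum_(t in rel_cells X A k.-1) boundary phi t ^+ 2.
Proof.
move=> k_gt0 AX; rewrite lerBlDr.
have -> : \sum_(t : {set T}) boundary phi t ^+ 2
   = \sum_(t in rel_cells X A k.-1) boundary phi t ^+ 2
     + \sum_(t in faces A k.-1) boundary phi t ^+ 2.
  rewrite (big_mkcond (mem (rel_cells _ _ _))) (big_mkcond (mem (faces A _))).
  rewrite -big_split; apply: eq_bigr => t _ /=; rewrite [in t \in rel_cells _ _ _]inE.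
  have [tA|tA] := boolP (t \in faces A k.-1); rewrite /= ?add0r ?addr0 //.
  by case: ifPn => // /boundary_supp->; rewrite ?expr0n.
rewrite lerD2l (eq_bigr _ boundary_discrete).
have -> : \sum_(t in faces A k.-1) \sum_v link_cochain phi t v ^+ 2
  = \sum_(t : {set T}) \sum_v (t \in faces A k.-1)%:R * link_cochain phi t v ^+ 2.
  rewrite big_mkcond; apply: eq_bigr => t _; rewrite -mulr_sumr.
  by case: ifP; rewrite ?mul1r ?mul0r.
rewrite (sum_link_sqr phi (fun t _ => (t \in faces A k.-1)%:R)) mulr_sumr.
apply: ler_sum => s _.
have [sC|/phi_supp->] := boolP (s \in cells); last by rewrite expr0n !mulr0.
rewrite ler_wpM2r ?sqr_ge0 // -natr_sum ler_nat.
have sX' : s \in faces X' k.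
  by have [_ sk] := cells_faces sC; rewrite inE (cell_trunc sC) sk /=.
apply: leq_trans (leq_bigmax_cond _ sX').
rewrite -big_mkcondr /= sum1_card.
have inj : {in [pred v in s | s :\ v \in faces A k.-1] &,
            injective (fun v => s :\ v)}.
  move=> v w /andP[vs _] /andP[ws _] vw; apply/eqP/negPn/negP=> vNw.
  by move/setP/(_ w): vw; rewrite !inE eqxx ws eq_sym vNw.
rewrite -(card_in_imset inj); apply: subset_leq_card; apply/subsetP=> t.
case/imsetP=> v /andP[vs svA] ->; rewrite inE svA andbT !inE subD1set andbT.
by move: svA; rewrite inE => /andP[/(subsetP AX)-> ->].
Qed.

End RelativeEnergy.

(** * Vanishing of relative homology *)

Section Exactness.
Variable R : rcfType.

Lemma tr_mul_eq0 m n (B : 'M[R]_(m, n)) (x : 'cV_n) :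
  B^T *m (B *m x) = 0 -> B *m x = 0.
Proof.
move=> BBx; apply/eqP; rewrite -normsq_eq0 trmx_mul -mulmxA BBx mulmx0.
by rewrite mxE.
Qed.

(** Coercivity makes L invertible, so z = L y.  Applying B kills z and the image
of D, hence B B^T (B y) = 0, which forces B^T (B y) = 0 and z = D (D^T y). *)
Lemma hodge_exact p n q (B : 'M[R]_(p, n)) (D : 'M[R]_(n, q)) (c : R) (z : 'cV_n) :
  let L := D *m D^T + B^T *m B in
  B *m D = 0 -> 0 < c ->
  (forall f : 'cV_n, c * (f^T *m f) 0 0 <= (f^T *m (L *m f)) 0 0) ->
  B *m z = 0 -> exists y, z = D *m y.
Proof.
move=> L BD c_gt0 Lc Bz.
have Lsym : L^T = L by rewrite linearD /= !trmx_mul !trmxK.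
have Linj (f : 'cV_n) : L *m f = 0 -> f = 0.
  move=> Lf; have := Lc f; rewrite Lf mulmx0 [leRHS]mxE pmulr_rle0 // => f_le0.
  by apply/eqP; rewrite -normsq_eq0 eq_le f_le0 normsq_ge0.
have Lunit : L \in unitmx.
  rewrite -row_free_unit; apply: inj_row_free => v vL.
  by apply: trmx_inj; rewrite trmx0; apply: Linj; rewrite -Lsym -trmx_mul vL trmx0.
have LE (y : 'cV_n) : L *m y = D *m (D^T *m y) + B^T *m (B *m y).
  by rewrite /L mulmxDl -!mulmxA.
have [y zE] : exists y, z = D *m (D^T *m y) + B^T *m (B *m y).
  by exists (invmx L *m z); rewrite -LE mulKVmx.
exists (D^T *m y); rewrite {1}zE -[RHS]addr0; congr (_ + _).
apply: (@tr_mul_eq0 _ _ B^T); rewrite trmxK.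
by rewrite -Bz zE mulmxDr (mulmxA B D) BD mul0mx add0r.
Qed.

End Exactness.

Section RelativeChains.
Variables (R : rcfType) (d : Order.disp_t) (T : finOrderType d).
Implicit Types (X A : {set {set T}}) (s t e : {set T}) (u v w : T).

Lemma eq_coboundary (phi psi : {set T} -> R) e :
  (forall v, v \in e -> phi (e :\ v) = psi (e :\ v)) ->
  coboundary phi e = coboundary psi e.
Proof. by move=> eq_phi; apply: eq_bigr => v /eq_phi->. Qed.

(** The two orders of removing v and w from e contribute opposite terms. *)
Lemma coboundary_coboundary (phi : {set T} -> R) e :
  coboundary (coboundary phi) e = 0.
Proof.
pose a v w := if (v \in e) && (w \in e) && (v != w) then
  face_sign R e v * (face_sign R (e :\ v) w * phi (e :\ v :\ w)) else 0.
have aE : coboundary (coboundary phi) e = \sum_v \sum_w a v w.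
  rewrite /coboundary big_mkcond; apply: eq_bigr => v _; rewrite /a.
  case: ifP => /= ve; last by rewrite big1.
  rewrite mulr_sumr big_mkcond; apply: eq_bigr => w _.
  by rewrite !inE eq_sym andbC.
have a_anti v w : a v w = - a w v.
  rewrite /a eq_sym [(w \in e) && _]andbC.
  case: ifP; last by rewrite oppr0.
  case/andP=> /andP[ve we] wv.
  have -> : e :\ w :\ v = e :\ v :\ w by rewrite !setDDl (setUC [set w]).
  by rewrite !mulrA face_sign_swap ?mulNr // eq_sym.
have : coboundary (coboundary phi) e = - coboundary (coboundary phi) e.
  rewrite aE -sumrN exchange_big; apply: eq_bigr => v _.
  by rewrite -sumrN; apply: eq_bigr => w _; apply: a_anti.
by move/eqP; rewrite -addr_eq0 -mulr2n mulrn_eq0 => /eqP.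
Qed.

Definition extend (C : {set {set T}}) (x : 'cV[R]_#|C|) s : R :=
  \sum_(i | enum_val i == s) x i 0.

Lemma extend_val (C : {set {set T}}) (x : 'cV[R]_#|C|) i : extend x (enum_val i) = x i 0.
Proof. by rewrite /extend (big_pred1 i) // => j; rewrite (inj_eq enum_val_inj). Qed.

Lemma extend_supp (C : {set {set T}}) (x : 'cV[R]_#|C|) s : s \notin C -> extend x s = 0.
Proof.
move=> sC; rewrite /extend big1 // => i /eqP iE.
by move: sC; rewrite -iE enum_valP.
Qed.

Lemma normsq_extend (C : {set {set T}}) (x : 'cV[R]_#|C|) :
  (x^T *m x) 0 0 = \sum_(s in C) extend x s ^+ 2.
Proof.
rewrite mxE [RHS]big_enum_val; apply: eq_bigr => i _.
by rewrite extend_val !mxE expr2.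
Qed.

Lemma sum_extend (C : {set {set T}}) (x : 'cV[R]_#|C|) (F : {set T} -> R) :
  \sum_i F (enum_val i) * x i 0 = \sum_(s : {set T}) F s * extend x s.
Proof.
transitivity (\sum_(s in C) F s * extend x s).
  by rewrite [RHS]big_enum_val; apply: eq_bigr => i _; rewrite extend_val.
rewrite big_mkcond; apply: eq_bigr => s _.
by case: ifPn => // sC; rewrite extend_supp ?mulr0.
Qed.

Lemma rel_boundaryE X A k (x : 'cV[R]_#|rel_cells X A k|) i :
  (rel_boundary R X A k *m x) i 0 = boundary (extend x) (enum_val i).
Proof.
rewrite mxE; under eq_bigr do rewrite mxE.
rewrite (sum_extend x (fun s => incidence R s (enum_val i))).
set t := enum_val i.
transitivity (\sum_(s : {set T}) \sum_(v in s)
   (s :\ v == t)%:R * (face_sign R s v * extend x s)).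
  apply: eq_bigr => s _; rewrite /incidence mulr_suml big_mkcondr.
  by apply: eq_bigr => v _; case: eqP => _; rewrite ?mul1r ?mul0r.
rewrite sum_flag (exchange_big_dep predT) //= /boundary; apply: eq_bigr => v _.
rewrite /link_cochain; have [vt|vt] := boolP (v \in t).
  rewrite big1 // => s vs; rewrite setU1K //.
  by case: eqP vt vs => [->|_ _ _]; rewrite ?mul0r // => ->.
rewrite (bigD1 t) //= setU1K // eqxx mul1r face_signD1 ?setU11 // setU1K // big1 ?addr0 //.
by move=> s /andP[vs st]; rewrite setU1K // (negPf st) mul0r.
Qed.

Lemma rel_coboundaryE X A k (x : 'cV[R]_#|rel_cells X A k|) j :
  ((rel_boundary R X A k.+1)^T *m x) j 0 = coboundary (extend x) (enum_val j).
Proof.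
rewrite mxE; under eq_bigr do rewrite !mxE.
rewrite (sum_extend x (fun s => incidence R (enum_val j) s)).
set e := enum_val j; rewrite /coboundary /incidence.
under eq_bigr do rewrite mulr_suml.
rewrite (exchange_big_dep (mem e)) /= => [|s v _ /andP[] //].
apply: eq_bigr => v ve; rewrite (big_pred1 (e :\ v)) // => s.
by rewrite ve /= eq_sym.
Qed.

(** Dually, relative coboundaries compose to zero: extended by 0, the relative
coboundary agrees with the absolute one at every face of X, since the latter
vanishes at the faces of A. *)
Lemma rel_boundary_boundary X A k : (0 < k)%N -> is_flag X ->
  (forall s t, s \in A -> t \subset s -> t \in A) ->
  rel_boundary R X A k *m rel_boundary R X A k.+1 = 0.
Proof.
case: k => // k _ hX A_down /=.
apply: trmx_inj; rewrite trmx_mul trmx0.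
suff ddx (x : 'cV_#|rel_cells X A k|) :
    (rel_boundary R X A k.+2)^T *m ((rel_boundary R X A k.+1)^T *m x) = 0.
  apply/matrixP=> i j; have := ddx (delta_mx j 0); rewrite mulmxA -colE.
  by move/colP/(_ i); rewrite !mxE.
apply/colP=> j; rewrite rel_coboundaryE mxE.
rewrite -[RHS](coboundary_coboundary (extend x) (enum_val j)).
apply: eq_coboundary => v ve.
have [eX _] := cells_faces (enum_valP j).
set s := enum_val j :\ v.
have sX : s \in X by apply: (flag_down hX eX); apply: subD1set.
have [sC|sC] := boolP (s \in rel_cells X A k.+1).
  by rewrite -[s](enum_rankK_in sC) // extend_val rel_coboundaryE.
rewrite extend_supp //; apply/esym.
by apply: coboundary_supp A_down _ sX sC => s1; apply: extend_supp.
Qed.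

End RelativeChains.

Theorem theorem1p9 (R : realType) (d : Order.disp_t) (T : finOrderType d)
    (X A : {set {set T}}) (k : nat)
    (hX : is_flag X) (hk : (1 <= k)%N)
    (hA : discrete_boundary X k A)
    (hne : faces X k :\: faces A k != set0) :
  let X' := trunc_complex X A k in
  let n' := #|vertices X'| in
  let m := \max_(s in faces X' k) #|subfaces X k.-1 s :&: faces A k.-1| in
  [/\ simplicial_complex X' /\ X' \subset X,
      mu R X A k >= k.+1%:R * lambda2 R (skeleton_graph X') - k%:R * n'%:R - m%:R
    & lambda2 R (skeleton_graph X') > k.+1%:R^-1 * (k%:R * n'%:R + m%:R) ->
      forall h : rel_homology R X A k, h = 0].
Proof.
move=> X' n' m; have [_ [A0 A_down] AX deg_A] := hA.
have [s0 s0C] : exists s, s \in rel_cells X A k by apply/set0Pn.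
have n_gt1 : (1 < n')%N.
  have [_ s0k] := cells_faces s0C.
  by apply: leq_trans (subset_leq_card (cell_vertices s0C)); rewrite s0k ltnS.
set l := lambda2 R _; set c := k.+1%:R * l - k%:R * n'%:R - m%:R.
have Lc (f : 'cV_#|rel_cells X A k|) :
    c * (f^T *m f) 0 0 <= (f^T *m (rel_laplacian R X A k *m f)) 0 0.
  pose phi := extend f; have phi0 := extend_supp f.
  have -> : (f^T *m (rel_laplacian R X A k *m f)) 0 0
    = \sum_(e in rel_cells X A k.+1) coboundary phi e ^+ 2
      + \sum_(t in rel_cells X A k.-1) boundary phi t ^+ 2.
    rewrite mulmxDl mulmxDr mxE; congr (_ + _).
      rewrite -[_ *m _ *m f]mulmxA mulmxA -[f^T *m _]trmxK trmx_mul trmxK.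
      rewrite mxE [RHS]big_enum_val; apply: eq_bigr => i _.
      by rewrite mxE rel_coboundaryE expr2.
    rewrite -[_ *m _ *m f]mulmxA mulmxA -trmx_mul mxE [RHS]big_enum_val.
    by apply: eq_bigr => i _; rewrite mxE rel_boundaryE expr2.
  have Ed := coboundary_energy_ge hX phi0 A_down hk n_gt1.
  have Eb := boundary_energy_ge hX phi0 deg_A hk AX.
  have -> : (f^T *m f) 0 0 = \sum_(s : {set T}) phi s ^+ 2.
    rewrite normsq_extend big_mkcond; apply: eq_bigr => s _.
    by case: ifPn => // /phi0; rewrite /phi => ->; rewrite expr0n.
  have l_le : l * n'%:R^-1 <= 1.
    by rewrite ler_pdivrMr ?mul1r ?lambda2_le_card // ltr0n ltnW.
  have B_ge0 : 0 <= \sum_(t : {set T}) boundary phi t ^+ 2.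
    by apply: sumr_ge0 => t _; rewrite sqr_ge0.
  have := ler_wpM2r B_ge0 l_le; move: Ed Eb; rewrite -/X' -/n' -/m -/l /c; lra.
have Lsym : (rel_laplacian R X A k)^T = rel_laplacian R X A k.
  by rewrite linearD /= !trmx_mul !trmxK.
split.
- split; last exact: trunc_sub.
  split; last by move=> s t; apply: trunc_down.
  exact: trunc_down (cell_trunc s0C) (sub0set _).
- have : mu R X A k \in eigenvalues (rel_laplacian R X A k).
    rewrite /mu -nth0 mem_nth // size_eigenvalues //.
    by apply/card_gt0P; exists s0.
  by case/eigenvalue_rayleigh=> f f_gt0 fE; rewrite -(ler_pM2r f_gt0) -fE; apply: Lc.
- rewrite mulrC ltr_pdivrMr ?ltr0n // => l_gt h.
  have c_gt0 : 0 < c by rewrite /c; lra.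
  elim/quotW: h => z; apply/eqP; rewrite piE Quotient.equivE subr0.
  have [y zE] : exists y, vsval z = rel_boundary R X A k.+1 *m y.
    apply: (@hodge_exact _ _ _ _ (rel_boundary R X A k) _ c) => //.
      exact: rel_boundary_boundary.
    by have := valP z; rewrite memv_ker lfunE => /eqP.
  rewrite unfold_in /cycle_is_boundary zE.
  by have := memv_img (linfun (mulmx (rel_boundary R X A k.+1))) (memvf y); rewrite lfunE.
Qed.
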